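(* Let $q$ be a power of an odd prime, let $n$ be an odd positive integer coprime to $q$, let $\gamma$ be an integer, and let $c_{n/q}(\gamma)$ be the $q$-cyclotomic coset modulo $n$ containing $\gamma$, with $|c_{n/q}(\gamma)|=\tau$. Assume that $q^{\tau}\equiv3\pmod4$. Then: (1) The generator $\varphi_n(\gamma)$ at infinity gives rise to an element $$c_\infty=(c_{2^in/q}(\gamma+n\cdot\varphi_n(\gamma)_{\le i-1}))_{i\in\mathbb{N}}\in\mathcal{PC}_{n/q}(\gamma),$$ where $\varphi_n(\gamma)_{\le-1}$ is set to be $0$. It is the unique splitting element of $\mathcal{PC}_{n/q}(\gamma)$. (2) For each $d\in\mathbb{N}$, the $d$-th generator $U_d(\gamma)$ gives rise to $2^{v^--1}$ elements $$c_{d,t}=(c_{2^in/q}(\gamma+n\cdot\widehat{U}_{d,t}(\gamma)_{\le i-1}))_{i\in\mathbb{N}}\in\mathcal{PC}_{n/q}(\gamma),$$ where $v^-=v_2(q^{\tau}+1)$, $t=(t_1,\dots,t_{v^--1})\in\{0,1\}^{v^--1}$, and $\widehat{U}_{d,t}(\gamma)=U_d(\gamma)+\sum_{j=1}^{v^--1}t_j\cdot2^{d+j+1}$; here $\widehat{U}_{d,t}(\gamma)_{\le-1}$ is set to be $0$. Furthermore, the element $c_\infty$ and the elements $c_{d,t}$, for all $d\in\mathbb{N}$ and all $t\in\{0,1\}^{v^--1}$, are pairwise distinct and exhaust $\mathcal{PC}_{n/q}(\gamma)$.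
   Context: $\mathbb{N}=\{0,1,2,\dots\}$. For $N\ge 1$ coprime to $q$, $c_{N/q}(\gamma)=\{\gamma q^j\bmod N:j\ge0\}\subseteq\mathbb{Z}/N\mathbb{Z}$ is the $q$-cyclotomic coset modulo $N$ containing $\gamma$, and $\mathcal{C}_{N/q}$ is the set of all such cosets. For $a\mid b$ coprime to $q$, $\pi_{b/a}:\mathbb{Z}/b\mathbb{Z}\to\mathbb{Z}/a\mathbb{Z}$ is the projection and $\widehat{\pi}_{b/a}:\mathcal{C}_{b/q}\to\mathcal{C}_{a/q}$ the induced map $c_{b/q}(\gamma)\mapsto c_{a/q}(\gamma)$. The $2$-adic $q$-cyclotomic system over $c_{n/q}(\gamma)$ is $\mathcal{PC}_{n/q}(\gamma)=\varprojlim_{i\in\mathbb{N}}\widehat{\pi}_{2^in/n}^{-1}(c_{n/q}(\gamma))$, i.e. the set of sequences $(c_{2^in/q}(\gamma_i))_{i\in\mathbb{N}}$ of cosets, with $0$-th component $c_{n/q}(\gamma)$, compatible under the maps $\widehat{\pi}$. A coset $c_{m/q}(\gamma)$ is splitting with respect to $\mathbb{Z}/2m\mathbb{Z}:\mathbb{Z}/m\mathbb{Z}$ if $\pi_{2m/m}^{-1}(c_{m/q}(\gamma))=c_{2m/q}(\gamma)\sqcup c_{2m/q}(m+\gamma)$ (disjoint cosets); otherwise the preimage is the single coset $c_{2m/q}(\gamma)=c_{2m/q}(m+\gamma)$. A sequence $(c_{2^in/q}(\gamma_i))_i\in\mathcal{PC}_{n/q}(\gamma)$ splits at degree $i_0$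 if $c_{2^{i_0}n/q}(\gamma_{i_0})$ is splitting with respect to $\mathbb{Z}/2^{i_0+1}n\mathbb{Z}:\mathbb{Z}/2^{i_0}n\mathbb{Z}$; it is splitting if it splits at every degree. For an integer $\gamma$, the cyclotomic $2$-adic integer $\varphi_n(\gamma)=\sum_{k\ge0}\phi_{n,k}(\gamma)2^k$, $\phi_{n,k}(\gamma)\in\{0,1\}$, is the unique such formal $2$-adic power series with $2^{i+1}\mid\gamma+n\cdot\varphi_n(\gamma)_{\le i}$ for all $i\in\mathbb{N}$. It is called the generator at infinity of $\mathcal{PC}_{n/q}(\gamma)$. For a series $Y=\sum_k y_k2^k$ with $y_k\in\{0,1\}$, $Y_{\le i}=\sum_{k=0}^iy_k2^k$. For $d\in\mathbb{N}$, the $d$-th generator is $U_d(\gamma)=\sum_{k=0}^{d-1}\phi_{n,k}(\gamma)2^k+(1-\phi_{n,d}(\gamma))2^d$. *)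

(* Defs.v *)
From mathcomp Require Import all_boot all_order all_algebra.
From mathcomp Require Import zify.
From Stdlib Require Import ClassicalEpsilon.

Set Implicit Arguments.
Unset Strict Implicit.
Unset Printing Implicit Defensive.

Import GRing.Theory.

Local Open Scope ring_scope.

(* The ring of integers modulo N, for N >= 1 only.  'Z_N is not usable here,   *)
(* since 'Z_1 is the ring with two elements and the modulus 1 does occur.      *)
Notation Zmod N := 'I_N.-1.+1.

Definition residue (N : nat) (z : int) : Zmod N := inZp `|(z %% N%:Z)%Z|%N.

(* fconnect f x is the set of iterates of f at x; see cyc_cosetP.              *)
Definition cyc_coset (N q : nat) (gamma : int) : {set Zmod N} :=
  [set y | fconnect (fun x : Zmod N => Zp_mul x (inZp q)) (residue N gamma) y].

Definition is_cyc_coset (N q : nat) (c : {set Zmod N}) : Prop :=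
  exists gamma : int, c = cyc_coset N q gamma.

Definition Zproj (b a : nat) (x : Zmod b) : Zmod a := inZp x.
Arguments Zproj : clear implicits.

(* The map induced by Zproj on cosets; see coset_proj_cyc_coset.               *)
Definition coset_proj (b a : nat) (c : {set Zmod b}) : {set Zmod a} :=
  [set Zproj b a x | x in c].
Arguments coset_proj : clear implicits.

Definition coset_system (n : nat) : Type :=
  forall i : nat, {set Zmod (2 ^ i * n)}.

(* Membership in the projective limit over i of the fibres of coset_proj over  *)
(* cyc_coset n q gamma.                                                        *)
Definition PC (n q : nat) (gamma : int) (c : coset_system n) : Prop :=
  (forall i, is_cyc_coset q (c i) /\
             coset_proj (2 ^ i * n) n (c i) = cyc_coset n q gamma) /\
  (forall i j, (i <= j)%N ->
             coset_proj (2 ^ j * n) (2 ^ i * n) (c j) = c i).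

Arguments PC : clear implicits.

Definition splitting_coset (m q : nat) (c : {set Zmod m}) : Prop :=
  exists gamma : int,
    [/\ c = cyc_coset m q gamma,
        Zproj (2 * m) m @^-1: c =
          cyc_coset (2 * m) q gamma :|: cyc_coset (2 * m) q (m%:Z + gamma)
      & [disjoint cyc_coset (2 * m) q gamma
                & cyc_coset (2 * m) q (m%:Z + gamma)]].

Definition splits_at (n q : nat) (c : coset_system n) (i : nat) : Prop :=
  splitting_coset q (c i).

Definition splitting_system (n q : nat) (c : coset_system n) : Prop :=
  forall i, splits_at q c i.

(* A formal 2-adic series is given by its coefficients, and trunc Y i is the   *)
(* sum of its terms of degree < i, i.e. the truncation Y_{<= i-1}.             *)
Definition trunc (Y : nat -> nat) (i : nat) : nat :=
  (\sum_(k < i) Y k * 2 ^ k)%N.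

Definition is_cyc_2adic (n : nat) (gamma : int) (phi : nat -> bool) : Prop :=
  forall i, ((2 ^ i.+1)%N%:Z %| gamma + (n * trunc phi i.+1)%N%:Z)%Z.

(* The unique series satisfying is_cyc_2adic; see cyc_2adicP, cyc_2adic_uniq.  *)
Definition cyc_2adic (n : nat) (gamma : int) : nat -> bool :=
  epsilon (inhabits (fun=> false)) (is_cyc_2adic n gamma).

Definition generator (n : nat) (gamma : int) (d k : nat) : nat :=
  if (k < d)%N then nat_of_bool (cyc_2adic n gamma k)
  else if k == d then (1 - cyc_2adic n gamma d)%N else 0%N.

(* The ordinal j stands for the 1-based index j + 1, so that tnth t j is the   *)
(* coefficient of 2 ^ (d + j + 2).  The sum is coefficientwise: no carries     *)
(* occur, as generator n gamma d vanishes beyond degree d.                     *)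
Definition generator_hat (n : nat) (gamma : int) (w d : nat)
    (t : w.-tuple bool) (k : nat) : nat :=
  (generator n gamma d k + \sum_(j < w) tnth t j * (k == d + j + 2))%N.

Definition system_of (n q : nat) (gamma : int) (Y : nat -> nat) :
    coset_system n :=
  fun i => cyc_coset (2 ^ i * n) q (gamma + (n * trunc Y i)%N%:Z).

Definition c_infty (n q : nat) (gamma : int) : coset_system n :=
  system_of n q gamma (cyc_2adic n gamma).

Definition c_fin (n q : nat) (gamma : int) (w d : nat) (t : w.-tuple bool) :
    coset_system n :=
  system_of n q gamma (generator_hat n gamma d t).

Lemma residueM (N q : nat) (z : int) :
  residue N (z * q%:Z) = Zp_mul (residue N z) (inZp q).
Proof.
apply: val_inj; case: N => [|N] /=; first by rewrite !modn1.
rewrite modnMml modnMmr; apply/eqP; rewrite -eqz_nat -!modz_nat; apply/eqP.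
by rewrite PoszM !gez0_abs ?modz_ge0 // modz_mod modzMml.
Qed.

Lemma residueMX (N q j : nat) (gamma : int) :
  residue N (gamma * q%:Z ^+ j) =
  iter j (fun x : Zmod N => Zp_mul x (inZp q)) (residue N gamma).
Proof.
elim: j => [|j IHj]; first by rewrite expr0 mulr1.
by rewrite iterS -IHj exprSr mulrA residueM.
Qed.

Lemma cyc_cosetP (N q : nat) (gamma : int) (y : Zmod N) :
  reflect (exists j : nat, y = residue N (gamma * q%:Z ^+ j))
          (y \in cyc_coset N q gamma).
Proof.
rewrite inE; apply: (iffP idP) => [/iter_findex <-|[j ->]].
  by eexists; rewrite residueMX.
by rewrite residueMX fconnect_iter.
Qed.

Lemma Zproj_residue (a b : nat) (z : int) : (0 < b)%N -> (a %| b)%N ->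
  Zproj b a (residue b z) = residue a z.
Proof.
case: b => // b _; case: a => [|a] ab; apply: val_inj => /=.
  by rewrite !modn1.
rewrite modn_dvdm //; apply/eqP; rewrite -eqz_nat -!modz_nat; apply/eqP.
rewrite !gez0_abs ?modz_ge0 // modz_mod.
by rewrite {2}(divz_eq z b.+1) -(divnK ab) PoszM mulrA modzMDl.
Qed.

Lemma coset_proj_cyc_coset (a b q : nat) (gamma : int) :
  (0 < b)%N -> (a %| b)%N ->
  coset_proj b a (cyc_coset b q gamma) = cyc_coset a q gamma.
Proof.
move=> b0 ab; apply/setP => y; apply/imsetP/cyc_cosetP => [[x]|[j ->]].
  by case/cyc_cosetP=> j -> ->; exists j; rewrite Zproj_residue.
exists (residue b (gamma * q%:Z ^+ j)); last by rewrite Zproj_residue.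
by apply/cyc_cosetP; exists j.
Qed.

Lemma truncS (Y : nat -> nat) i : trunc Y i.+1 = (trunc Y i + Y i * 2 ^ i)%N.
Proof. by rewrite /trunc big_ord_recr. Qed.

Lemma is_cyc_2adic_exists (n : nat) (gamma : int) :
  odd n -> exists phi, is_cyc_2adic n gamma phi.
Proof.
move=> n_odd.
pose step (k t : nat) : bool :=
  ~~ ((2 ^ k.+1)%N%:Z %| gamma + (n * t)%N%:Z)%Z.
pose T := fix T k := if k is k'.+1 then (T k' + step k' (T k') * 2 ^ k')%N
                     else 0%N.
pose phi k := step k (T k).
have TE k : trunc phi k = T k.
  by elim: k => [|k IHk]; [rewrite /trunc big_ord0 | rewrite truncS IHk].
exists phi.
have Td k : ((2 ^ k)%N%:Z %| gamma + (n * T k)%N%:Z)%Z.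
  elim: k => [|k /dvdzP[u Hu]] /=; first by rewrite expn0 dvd1z.
  rewrite /step; case: (boolP ((2 ^ k.+1)%N%:Z %| gamma + (n * T k)%N%:Z)%Z) => [|nd] /=.
    by rewrite mul0n addn0.
  have k0 : (2 ^ k)%N%:Z != 0 by rewrite eqz_nat -lt0n expn_gt0.
  move: nd; rewrite mul1n mulnDr PoszD addrA Hu expnS !PoszM -mulrDl.
  rewrite !dvdz_mul2r //; move: n_odd; lia.
by move=> i; rewrite TE; apply: Td.
Qed.

Lemma cyc_2adicP (n : nat) (gamma : int) :
  odd n -> is_cyc_2adic n gamma (cyc_2adic n gamma).
Proof. by move=> n_odd; apply: epsilon_spec; apply: is_cyc_2adic_exists. Qed.

Lemma cyc_2adic_uniq (n : nat) (gamma : int) (phi : nat -> bool) :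
  odd n -> is_cyc_2adic n gamma phi -> phi =1 cyc_2adic n gamma.
Proof.
move=> n_odd Hphi; have := cyc_2adicP gamma n_odd.
move: (cyc_2adic n gamma) => psi Hpsi.
suff H k : trunc phi k = trunc psi k.
  move=> k; have := H k.+1; rewrite !truncS H => /addnI /eqP.
  by rewrite eqn_pmul2r ?expn_gt0 //; case: (phi k) (psi k) => [] [].
elim: k => [|k IHk]; first by rewrite /trunc !big_ord0.
have := rpredB (Hphi k) (Hpsi k).
rewrite !truncS IHk !mulnDr !PoszD !addrA opprD addrACA subrr add0r.
rewrite expnS !mulnA !PoszM -mulrBl dvdz_mul2r; last first.
  by rewrite eqz_nat -lt0n expn_gt0.
case: (phi k) (psi k) => [] [] //=; move: n_odd; lia.
Qed.

(* Main.v *)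
(* Every coset of the system over c_{n/q}(gamma) has representatives congruent *)
(* to gamma mod n, and on these only the powers of Q = q ^ tau act.  So the    *)
(* system is the set of orbits of the closure of Q^Z in the 2-adic units,      *)
(* acting on the 2-adic integers gamma + n * Y.  The orbit of 0 is c_infty;    *)
(* all others consist of elements of a fixed valuation d.  Since Q = 3 mod 4,  *)
(* the closure of Q^Z is generated by Q and 1 + 2 ^ (v + 1) Z_2, so an orbit   *)
(* of valuation d meets each odd class mod 4 (after division by 2 ^ d) in      *)
(* exactly one class mod 2 ^ (v + 1): the v - 1 free binary digits of          *)
(* U_{d,t} parametrize these.  A coset is splitting in degree i exactly when   *)
(* 2 ^ i divides its representatives, which singles out c_infty.               *)

Require Import Defs.
From mathcomp Require Import all_boot all_order all_algebra.
From mathcomp Require Import zify ring.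
From Stdlib Require Import FunctionalExtensionality Classical.

Import GRing.Theory.

Local Open Scope ring_scope.

(** Put Q = q^tau. By [cyc_coset_fibre_eqP], two representatives congruent to g mod n give the same
    coset at level i exactly when a power of Q carries one to the other modulo 2^i, so the system is
    studied through Q-orbits of integers modulo powers of 2. The valuation is an orbit invariant.
    For valuation d, lifting the exponent ([exp_pow2_sub1]) gives [orbit_of_close]: congruence
    modulo 2^(d+v+1) puts two numbers in one orbit at every precision. By [close_of_orbit] it is
    also necessary once they agree modulo 2^(d+2), and [orbit_mod_pow2SS] always arranges that
    agreement. The v-1 binary digits between the two moduli form the tuple t, whence [c_fin_inj] and
    [PC_exhaust]. Finally [splitting_of_pow2_dvd] and [not_splitting_exact_pow2] tie splitting to
    divisibility of representatives by 2^i, which holds at all levels only for [c_infty]. *)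

Local Notation pow2 d := ((2 ^ d)%N%:Z).

(** * Divisibility and congruences *)

Lemma pow2_gt0 d : (0 < 2 ^ d)%N.
Proof. by rewrite expn_gt0. Qed.

Lemma pow2_neq0 d : pow2 d != 0.
Proof. by rewrite eqz_nat -lt0n expn_gt0. Qed.

Lemma pow2S d : pow2 d.+1 = 2 * pow2 d.
Proof. by rewrite expnS PoszM. Qed.

Lemma dvdz_pow2 i j (a : int) :
  (i <= j)%N -> (pow2 j %| a)%Z -> (pow2 i %| a)%Z.
Proof. by move=> ij; apply: dvdz_trans; apply: dvdn_exp2l. Qed.

Lemma dvdz_sub_trans (N a b c : int) :
  (N %| a - b)%Z -> (N %| b - c)%Z -> (N %| a - c)%Z.
Proof. by move=> H1 H2; have := rpredD H1 H2; rewrite addrA subrK. Qed.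

Lemma dvdz_sub_sym (N a b : int) : (N %| a - b)%Z -> (N %| b - a)%Z.
Proof. by rewrite -opprB rpredN. Qed.

Lemma dvdz_congr (N a b : int) : (N %| a - b)%Z -> (N %| a)%Z = (N %| b)%Z.
Proof. by move=> H; rewrite -{1}(subrK b a) rpredDl. Qed.

(** * Cyclotomic cosets as orbits of multiplication by q *)

Lemma residue_eqP (N : nat) (a b : int) : (0 < N)%N ->
  reflect (residue N a = residue N b) (N%:Z %| a - b)%Z.
Proof.
case: N => // N _; rewrite -eqz_mod_dvd.
apply: (iffP eqP) => [H | /(congr1 val) /= H].
  by apply: val_inj => /=; rewrite H.
apply/eqP; rewrite -(modz_mod a) -(modz_mod b).
rewrite -[X in (X %% _)%Z]gez0_abs ?modz_ge0 //.
rewrite -[X in _ == (X %% _)%Z]gez0_abs ?modz_ge0 //.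
by rewrite !modz_nat eqz_nat H.
Qed.

Lemma coprimez_dvdzMXr (N q j : nat) (a : int) : coprime N q ->
  (N%:Z %| a * q%:Z ^+ j)%Z = (N%:Z %| a)%Z.
Proof.
by move=> Nq; rewrite Gauss_dvdzl // coprimezXr // /coprimez /gcdz /= (eqP Nq).
Qed.

(** Injectivity on a finite type makes [fconnect] symmetric, so that cosets are equal as soon as
    they meet. *)
Lemma residueM_inj (N q : nat) : (0 < N)%N -> coprime N q ->
  injective (fun x : Zmod N => Zp_mul x (inZp q)).
Proof.
move=> N0 Nq x y.
have resK (z : Zmod N) : z = residue N (val z)%:Z.
  case: N N0 z {x y Nq} => // N _ z; apply: val_inj => /=.
  by rewrite modz_nat absz_nat modn_mod modn_small.
rewrite (resK x) (resK y) -!residueM => /(residue_eqP _ _ _ N0).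
rewrite -mulrBl -[q%:Z]expr1 coprimez_dvdzMXr // => H.
exact/residue_eqP.
Qed.

Lemma cyc_coset_eqP (N q : nat) (a b : int) : (0 < N)%N -> coprime N q ->
  cyc_coset N q a = cyc_coset N q b <->
  exists j : nat, (N%:Z %| b - a * q%:Z ^+ j)%Z.
Proof.
move=> N0 Nq; split=> [E | [j Hj]].
  have : residue N b \in cyc_coset N q a by rewrite E inE connect0.
  by case/cyc_cosetP=> j /(residue_eqP _ _ _ N0) ?; exists j.
have inj := residueM_inj _ _ N0 Nq.
apply/setP=> y; rewrite !inE; apply: same_connect; first exact: fconnect_sym.
by move/(residue_eqP _ _ _ N0): Hj => ->; rewrite residueMX fconnect_iter.
Qed.

(** Multiplying a representative by a suitable power of q normalizes it modulo n, as
    [cyc_coset_fibre_eqP] requires. *)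
Lemma cyc_coset_rep (n N q : nat) (a g : int) :
  (n %| N)%N -> (0 < N)%N -> coprime N q ->
  cyc_coset n q a = cyc_coset n q g ->
  exists2 b, (n%:Z %| b - g)%Z & cyc_coset N q a = cyc_coset N q b.
Proof.
move=> nN N0 Nq.
have n0 : (0 < n)%N by apply: (dvdn_gt0 N0 nN).
case/cyc_coset_eqP=> // [|j Hj]; first exact: coprime_dvdl Nq.
exists (a * q%:Z ^+ j); first exact: dvdz_sub_sym.
by apply/cyc_coset_eqP=> //; exists j; rewrite subrr rpred0.
Qed.

(** The size of the coset is the period of g under the permutation given by q. *)
Lemma dvd_card_cyc_coset (N q j : nat) (g : int) : (0 < N)%N -> coprime N q ->
  (N%:Z %| g * q%:Z ^+ j - g)%Z = (#|cyc_coset N q g| %| j)%N.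
Proof.
move=> N0 Nq; set f := fun x : Zmod N => Zp_mul x (inZp q).
have inj : injective f by apply: residueM_inj.
have -> : #|cyc_coset N q g| = order f (residue N g) by rewrite cardsE.
set x := residue N g.
have itK k : iter (k * order f x) f x = x.
  by elim: k => // k IHk; rewrite mulSn iterD IHk iter_order.
have -> : (N%:Z %| g * q%:Z ^+ j - g)%Z = (iter j f x == x).
  by rewrite -residueMX; apply/residue_eqP/eqP.
apply/eqP/dvdnP => [|[k ->]]; last exact: itK.
rewrite {1}(divn_eq j (order f x)) addnC iterD itK => H.
exists (j %/ order f x)%N; rewrite {1}(divn_eq j (order f x)).
have r_lt : (j %% order f x < order f x)%N by rewrite ltn_mod order_gt0.
by have := findex_iter r_lt; rewrite H findex0 => <-; rewrite addn0.
Qed.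

(** * Reduction to powers of 2, and exact valuations *)

Lemma dvdz_pow2M i n (z : int) : odd n ->
  ((2 ^ i * n)%N%:Z %| z)%Z = (pow2 i %| z)%Z && (n%:Z %| z)%Z.
Proof.
move=> n_odd; rewrite PoszM Gauss_dvdz // /coprimez /gcdz /=.
by apply/eqP; congr Posz; apply/eqP/coprimeXl; rewrite coprime2n.
Qed.

Lemma coprime_pow2M i n q : odd q -> coprime n q -> coprime (2 ^ i * n) q.
Proof.
by move=> q_odd nq; rewrite coprimeMl nq andbT; apply: coprimeXl; rewrite coprime2n.
Qed.

(* q ^ j fixes g mod n exactly when tau divides j.                             *)
Lemma cyc_coset_fibre_eqP (i n q tau : nat) (g a b : int) :
  (0 < n)%N -> odd n -> odd q -> coprime n q ->
  #|cyc_coset n q g| = tau ->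
  (n%:Z %| a - g)%Z -> (n%:Z %| b - g)%Z ->
  cyc_coset (2 ^ i * n) q a = cyc_coset (2 ^ i * n) q b <->
  exists k : nat, (pow2 i %| b - a * (q ^ tau)%N%:Z ^+ k)%Z.
Proof.
move=> n0 n_odd q_odd nq tauE Ha Hb.
have N0 : (0 < 2 ^ i * n)%N by rewrite muln_gt0 pow2_gt0.
have Nq := coprime_pow2M i _ _ q_odd nq.
have QE k : (q ^ tau)%N%:Z ^+ k = q%:Z ^+ (tau * k).
  by rewrite -!natz -!natrX !natz expnM.
(* As a and b are both g modulo n, the n-part of the relation only says that q^m fixes g. *)
have aM m : (n%:Z %| b - a * q%:Z ^+ m)%Z = (n%:Z %| g * q%:Z ^+ m - g)%Z.
  rewrite -rpredN opprB; apply: dvdz_congr.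
  have -> : a * q%:Z ^+ m - b - (g * q%:Z ^+ m - g)
            = (a - g) * q%:Z ^+ m - (b - g) by ring.
  by rewrite rpredB // dvdz_mulr.
split=> [/(cyc_coset_eqP _ _ _ _ N0 Nq) [j] | [k Hk]].
  rewrite dvdz_pow2M // aM dvd_card_cyc_coset // tauE => /andP[Hj /dvdnP[k jE]].
  by exists k; rewrite QE mulnC -jE.
apply/cyc_coset_eqP=> //; exists (tau * k)%N.
by rewrite dvdz_pow2M // aM dvd_card_cyc_coset // tauE dvdn_mulr // andbT -QE.
Qed.

Definition exact_pow2 (d : nat) (a : int) : bool :=
  (pow2 d %| a)%Z && ~~ (pow2 d.+1 %| a)%Z.

Lemma exact_pow2P d a :
  reflect (exists y : int, a = pow2 d * (2 * y + 1)) (exact_pow2 d a).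
Proof.
apply: (iffP andP) => [[/dvdzP[u ->]] | [y ->]].
  rewrite pow2S dvdz_mul2r ?pow2_neq0 // => Hu.
  by exists (u %/ 2)%Z; rewrite mulrC; congr (_ * _); lia.
rewrite dvdz_mulr // pow2S mulrC dvdz_mul2r ?pow2_neq0 //; split=> //; lia.
Qed.

Lemma exact_pow2_sub d a b :
  (pow2 d.+1 %| a - b)%Z -> exact_pow2 d a = exact_pow2 d b.
Proof.
move=> H; rewrite /exact_pow2 (dvdz_congr _ _ _ H) (dvdz_congr (pow2 d) a b) //.
exact: dvdz_pow2 H.
Qed.

Lemma exact_pow2_inj d d' a : exact_pow2 d a -> exact_pow2 d' a -> d = d'.
Proof.
move=> /andP[a1 a2] /andP[a'1 a'2]; case: (ltngtP d d') => // lt_dd.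
  by case/negP: a2; apply: dvdz_pow2 a'1.
by case/negP: a'2; apply: dvdz_pow2 a1.
Qed.

Lemma dvdz_pow2_odd d (a u : int) : ~~ (2 %| u)%Z ->
  (pow2 d %| a * u)%Z = (pow2 d %| a)%Z.
Proof.
move=> u_odd; apply: Gauss_dvdzl; rewrite /coprimez /gcdz /=.
apply/eqP; congr Posz.
by apply/eqP/coprimeXl; rewrite coprime2n; lia.
Qed.

Lemma exact_pow2_odd d (a u : int) : ~~ (2 %| u)%Z ->
  exact_pow2 d (a * u) = exact_pow2 d a.
Proof. by move=> u_odd; rewrite /exact_pow2 !dvdz_pow2_odd. Qed.

Lemma oddz_exp (Q k : nat) : odd Q -> ~~ (2 %| Q%:Z ^+ k)%Z.
Proof. by move=> Qo; rewrite -natz -natrX natz; have := oddX Q k; lia. Qed.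

(** * Orbits under powers of Q, for Q = 3 mod 4 *)

Section OrbitsOfThreeMod4.

Variable Q : nat.
Hypothesis Q3 : (Q = 3 %[mod 4])%N.
Let v := logn 2 (Q + 1).

Let Q_odd : odd Q. Proof. lia. Qed.

Lemma logn2_ge2 : (2 <= v)%N.
Proof. by rewrite /v -pfactor_dvdn //; lia. Qed.

(** Lifting the exponent. At the start, Q^2 - 1 = (Q + 1)(Q - 1) where Q - 1 is twice an odd number;
    each squaring then adds one to the valuation. *)
Lemma exp_pow2_sub1 s : exact_pow2 (v + s.+1) (Q%:Z ^+ (2 ^ s.+1) - 1).
Proof.
elim: s => [|s /exact_pow2P[y Hy]].
  have [u u_odd Hu] : exists2 u, odd u & (Q + 1 = u * 2 ^ v)%N.
    have [|u Hc ->] := pfactor_coprime (isT : prime 2) (_ : 0 < Q + 1)%N.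
      by rewrite addn1.
    by exists u; rewrite // -coprime2n.
  have -> : Q%:Z ^+ (2 ^ 1) - 1 = (Q + 1)%N%:Z * (Q%:Z - 1).
    by rewrite expn1 PoszD; ring.
  apply/exact_pow2P; rewrite (addn1 v) pow2S Hu PoszM.
  have [z Hz] : exists z : int, u%:Z * (Q%:Z - 1) = 2 * (2 * z + 1).
    have [a ->] : exists a : nat, u = (2 * a + 1)%N by exists u./2; lia.
    have [b ->] : exists b : nat, Q = (4 * b + 3)%N by exists (Q %/ 4)%N; lia.
    exists (2 * a%:Z * b%:Z + a%:Z + b%:Z).
    by rewrite !(PoszD, PoszM); ring.
  by exists z; rewrite mulrAC Hz; ring.
have [w Hw] : exists w, (v + s.+1 = w.+2)%N.
  by have := logn2_ge2; exists (v + s).-1; lia.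
rewrite expnSr exprM addnS Hw.
move: Hy; rewrite Hw !pow2S.
move: (Q%:Z ^+ _) => X HX; apply/exact_pow2P.
(* With c = 2y + 1, the square of 1 + 2^(w+2) c is 1 + 2^(w+3) (c + 2^(w+1) c^2), and the last
   factor is odd. *)
exists (y + pow2 w * (2 * y + 1) ^+ 2).
have -> : X = 1 + 2 * (2 * pow2 w) * (2 * y + 1) by rewrite -HX; ring.
by rewrite !pow2S; ring.
Qed.

Lemma odd_exp_mod4 k : (4 %| Q%:Z ^+ k - 1)%Z = ~~ odd k.
Proof.
have -> : (4 %| Q%:Z ^+ k - 1)%Z = (Q ^ k %% 4 == 1)%N.
  by rewrite -natz -natrX natz; lia.
rewrite -modnXm Q3 -(odd_double_half k) -mul2n expnD expnM -modnMm.
by rewrite -(modnXm _ 4 (3 ^ 2)) exp1n; case: odd; rewrite !(oddD, oddM).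
Qed.

(* If a Q^k - b is exactly divisible by 2^j, replacing k by k + 2^(j-d-v)      *)
(* gains a factor of 2.                                                        *)
Lemma orbit_of_close d (a b : int) j :
  exact_pow2 d a -> (pow2 (d + v.+1) %| b - a)%Z ->
  exists k : nat, (pow2 j %| b - a * Q%:Z ^+ k)%Z.
Proof.
move=> Ha Hab; have [jle|jgt] := leqP j (d + v.+1).
  by exists 0%N; rewrite expr0 mulr1; apply: dvdz_pow2 Hab.
rewrite -(subnKC (ltnW jgt)); elim: (j - _)%N => [|r [k Hk]].
  by exists 0%N; rewrite expr0 mulr1 addn0.
case: (boolP (pow2 (d + v.+1 + r.+1) %| b - a * Q%:Z ^+ k)%Z) => [H|nH].
  by exists k.
(* The change a Q^k (Q^(2^(r+1)) - 1) has valuation d+v+r+1, the same as the defect; a difference of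
   two odd multiples gains a factor 2. *)
exists (k + 2 ^ r.+1)%N.
have /exact_pow2P[y Hy] : exact_pow2 d (a * Q%:Z ^+ k).
  by rewrite exact_pow2_odd ?oddz_exp.
have /exact_pow2P[z Hz] := exp_pow2_sub1 r.
have /exact_pow2P[x Hx] : exact_pow2 (d + v.+1 + r) (b - a * Q%:Z ^+ k).
  by rewrite /exact_pow2 Hk -addnS.
rewrite exprD mulrA -(subrK 1 (Q%:Z ^+ (2 ^ r.+1))) mulrDr mulr1 opprD addrCA.
rewrite Hx Hz Hy (addnS (d + v.+1)) pow2S.
have -> : pow2 (d + v.+1 + r) = pow2 d * pow2 (v + r.+1).
  by rewrite -PoszM -expnD; congr (Posz (2 ^ _)); lia.
apply/dvdzP; exists (x - (2 * y * z + y + z)); ring.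
Qed.

(** Agreement modulo 2^(d+2) forces Q^k = 1 mod 4, so k is even. Then Q^2 - 1, hence 2^(v+1),
    divides Q^k - 1. *)
Lemma close_of_orbit d (a b : int) k :
  exact_pow2 d a -> (pow2 d.+2 %| b - a)%Z ->
  (pow2 (d + v.+1) %| b - a * Q%:Z ^+ k)%Z -> (pow2 (d + v.+1) %| b - a)%Z.
Proof.
move=> Ha Hab Hk; have v2 := logn2_ge2.
have : (pow2 d.+2 %| a * (Q%:Z ^+ k - 1))%Z.
  have -> : a * (Q%:Z ^+ k - 1) = (b - a) - (b - a * Q%:Z ^+ k) by ring.
  by rewrite rpredB //; apply: dvdz_pow2 Hk; lia.
have /exact_pow2P[y Hy] := Ha.
have -> : a * (Q%:Z ^+ k - 1) = (Q%:Z ^+ k - 1) * (2 * y + 1) * pow2 d.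
  by rewrite Hy; ring.
rewrite !pow2S mulrA dvdz_mul2r ?pow2_neq0 // => H4.
have {}H4 : (4 %| Q%:Z ^+ k - 1)%Z.
  by rewrite -(dvdz_pow2_odd 2 _ (2 * y + 1)) //; lia.
move: H4; rewrite odd_exp_mod4 => k_even.
have kE : k = (2 ^ 1 * k./2)%N by lia.
have H1 : (pow2 v.+1 %| Q%:Z ^+ k - 1)%Z.
  rewrite {1}kE exprM subrX1 dvdz_mulr //.
  by have /andP[] := exp_pow2_sub1 0; rewrite (addn1 v).
have H2 : (pow2 (d + v.+1) %| a * (Q%:Z ^+ k - 1))%Z.
  by rewrite Hy -mulrA expnD PoszM dvdz_mul ?dvdz_mull.
by have := rpredD Hk H2; congr dvdz; ring.
Qed.

Lemma orbit_mod_pow2SS d (a b : int) :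
  exact_pow2 d a -> exact_pow2 d b ->
  exists k : nat, (pow2 d.+2 %| b - a * Q%:Z ^+ k)%Z.
Proof.
move=> /exact_pow2P[y ->] /exact_pow2P[z ->].
(* Q is -1 modulo 4: the exponent is 0 if the odd parts agree modulo 4, and 1 otherwise. *)
exists (~~ (2 %| z - y)%Z : nat).
have -> (u : int) : pow2 d * (2 * z + 1) - pow2 d * (2 * y + 1) * u
                     = ((2 * z + 1) - (2 * y + 1) * u) * pow2 d by ring.
rewrite !pow2S mulrA dvdz_mul2r ?pow2_neq0 //.
have [m ->] : exists m : nat, Q = (4 * m + 3)%N by exists (Q %/ 4)%N; lia.
case: (boolP (2 %| z - y)%Z) => H; rewrite ?expr0 ?expr1; last first.
  have [c Hc] : exists c : int, z = y + 2 * c + 1.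
    by exists ((z - y) %/ 2)%Z; lia.
  apply/dvdzP; exists (c - y - (2 * y + 1) * m%:Z).
  rewrite Hc PoszD PoszM; ring.
lia.
Qed.

Lemma exact_pow2_orbit i d (a b : int) k : (d < i)%N ->
  (pow2 i %| b - a * Q%:Z ^+ k)%Z -> exact_pow2 d b = exact_pow2 d a.
Proof.
move=> di H; rewrite -(exact_pow2_odd d a (Q%:Z ^+ k)) ?oddz_exp //.
by apply: exact_pow2_sub; apply: dvdz_pow2 H.
Qed.

End OrbitsOfThreeMod4.

(** * Truncated binary series and the digits of the generators *)

Lemma eq_cyc_coset (N q : nat) (a b : int) : (0 < N)%N ->
  (N%:Z %| a - b)%Z -> cyc_coset N q a = cyc_coset N q b.
Proof. by move=> N0 /(residue_eqP _ _ _ N0) ab; rewrite /cyc_coset ab. Qed.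

Lemma truncB_dvd (Y : nat -> nat) i j : (i <= j)%N ->
  (pow2 i %| (trunc Y j)%:Z - (trunc Y i)%:Z)%Z.
Proof.
move=> /subnKC <-; elim: (j - i)%N => [|k IHk].
  by rewrite addn0 subrr rpred0.
rewrite addnS truncS PoszD addrAC rpredD // PoszM dvdz_mull //.
exact/dvdn_exp2l/leq_addr.
Qed.

Lemma eq_trunc (Y Y' : nat -> nat) j :
  (forall k, (k < j)%N -> Y k = Y' k) -> trunc Y j = trunc Y' j.
Proof. by move=> E; apply: eq_bigr => k _; rewrite E. Qed.

Lemma trunc_lt (Y : nat -> nat) j :
  (forall k, Y k <= 1)%N -> (trunc Y j < 2 ^ j)%N.
Proof.
move=> Y1; elim: j => [|j IHj]; first by rewrite /trunc big_ord0.
rewrite truncS expnS mul2n -addnn -addSn leq_add //.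
by rewrite -[leqRHS]mul1n leq_mul2r Y1 orbT.
Qed.

Lemma trunc_inj (Y Y' : nat -> nat) j :
  (forall k, Y k <= 1)%N -> (forall k, Y' k <= 1)%N ->
  trunc Y j = trunc Y' j -> forall k, (k < j)%N -> Y k = Y' k.
Proof.
move=> Y1 Y'1; elim: j => // j IHj; rewrite !truncS => E.
have lt1 := trunc_lt _ j Y1; have lt2 := trunc_lt _ j Y'1.
have Ej : trunc Y j = trunc Y' j.
  have := congr1 (modn^~ (2 ^ j)%N) E.
  by rewrite /= ![(trunc _ _ + _)%N]addnC !modnMDl !modn_small.
move=> k; rewrite ltnS leq_eqVlt => /predU1P[->|]; last exact: IHj.
by move/eqP: E; rewrite Ej eqn_add2l eqn_pmul2r ?pow2_gt0 // => /eqP.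
Qed.

(** An odd n is invertible modulo 2^j, and a truncation with binary digits is smaller than 2^j. *)
Lemma trunc_affine_inj (n j : nat) (a : int) (Y Y' : nat -> nat) : odd n ->
  (forall k, Y k <= 1)%N -> (forall k, Y' k <= 1)%N ->
  (pow2 j %| (a + (n * trunc Y j)%N%:Z) - (a + (n * trunc Y' j)%N%:Z))%Z ->
  trunc Y j = trunc Y' j.
Proof.
move=> n_odd Y1 Y'1.
rewrite opprD addrACA subrr add0r !PoszM -mulrBr mulrC dvdz_pow2_odd; last lia.
rewrite -eqz_mod_dvd !modz_nat eqz_nat !modn_small ?trunc_lt //.
by move/eqP.
Qed.

Section GeneratorDigits.

Variables (n : nat) (g : int) (w d : nat) (t : w.-tuple bool).
Let phi := cyc_2adic n g.

Lemma generator_hat_low k :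
  (k < d.+2)%N -> generator_hat n g d t k = generator n g d k.
Proof.
move=> kd; rewrite /generator_hat big1 ?addn0 // => j _.
case: eqP => [E|_]; last by rewrite muln0.
by move: kd; rewrite E addn2 !ltnS ltnNge leq_addr.
Qed.

(** Digits past the end of t vanish, which the default [false] of [nth] expresses. *)
Lemma generator_hat_high m : generator_hat n g d t (d.+2 + m) = nth false t m.
Proof.
rewrite /generator_hat /generator.
have -> : (d.+2 + m < d)%N = false by lia.
have -> : (d.+2 + m == d)%N = false by lia.
rewrite add0n; under eq_bigr => j _.
  have -> : (d.+2 + m == d + j + 2)%N = (m == j)%N by lia.
  over.
have [mw|wm] := ltnP m w; last first.
  rewrite nth_default ?size_tuple // big1 // => j _.
  by case: eqP => [E|_]; [move: (ltn_ord j); lia | rewrite muln0].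
rewrite (bigD1 (Ordinal mw)) //= eqxx muln1 big1 ?addn0 => [|j].
  by rewrite (tnth_nth false).
by rewrite -val_eqE eq_sym /= => /negbTE ->; rewrite muln0.
Qed.

Lemma generator_hat_le1 k : (generator_hat n g d t k <= 1)%N.
Proof.
have [kd|dk] := ltnP k d.+2; last first.
  by rewrite -(subnKC dk) generator_hat_high leq_b1.
rewrite generator_hat_low // /generator.
by case: ifP => _; [exact: leq_b1 | case: ifP => // _; exact: leq_subr].
Qed.

(** With the digits of [phi] up to d the value would be divisible by 2^(d+1). Flipping digit d
    changes it by an odd multiple of 2^d; higher digits only add multiples of 2^(d+1). *)
Lemma exact_pow2_generator_hat j : odd n -> (d < j)%N ->
  exact_pow2 d (g + (n * trunc (generator_hat n g d t) j)%N%:Z).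
Proof.
move=> n_odd dj; have /dvdzP[u Hu] := cyc_2adicP g n_odd d.
rewrite (@exact_pow2_sub d _ (g + (n * trunc (generator_hat n g d t) d.+1)%N%:Z)).
  rewrite truncS generator_hat_low // /generator ltnn eqxx.
  have -> : trunc (generator_hat n g d t) d = trunc phi d.
    apply: eq_trunc => k kd.
    by rewrite generator_hat_low 1?(ltn_trans kd) // /generator kd.
  apply/exact_pow2P; move: Hu; rewrite truncS pow2S -/phi.
  have [m ->] : exists m : nat, n = (2 * m + 1)%N by exists n./2; lia.
  case: (phi d); rewrite !(PoszD, PoszM) => Hu.
    by exists (u - m%:Z - 1); lia.
  by exists (u + m%:Z); lia.
rewrite opprD addrACA subrr add0r !PoszM -mulrBr dvdz_mull //.
exact: truncB_dvd.
Qed.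

End GeneratorDigits.

(** * Elements of the projective limit, and splitting of cosets *)

Lemma expn2M_gt0 i n : (0 < n)%N -> (0 < 2 ^ i * n)%N.
Proof. by rewrite muln_gt0 pow2_gt0. Qed.

Lemma PC_system_of n q g (Y : nat -> nat) :
  (0 < n)%N -> PC n q g (system_of n q g Y).
Proof.
move=> n0; split=> [i|i j ij].
  split; first by eexists.
  rewrite coset_proj_cyc_coset ?expn2M_gt0 ?dvdn_mull //.
  by apply: eq_cyc_coset => //; rewrite addrAC subrr add0r PoszM dvdz_mulr.
rewrite coset_proj_cyc_coset ?expn2M_gt0 ?dvdn_mul ?dvdn_exp2l //.
apply: eq_cyc_coset; first exact: expn2M_gt0.
rewrite opprD addrACA subrr add0r !PoszM -mulrBr mulrC dvdz_mul //.
exact: truncB_dvd.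
Qed.

(** Lower components are projections of higher ones, so agreement at cofinally many levels
    suffices. *)
Lemma PC_ext n q g (c c' : coset_system n) :
  PC n q g c -> PC n q g c' ->
  (forall i, exists2 j, (i <= j)%N & c j = c' j) -> c = c'.
Proof.
move=> [_ cP] [_ cP'] E; apply: functional_extensionality_dep => i.
by have [j ij Ej] := E i; rewrite -(cP i j ij) -(cP' i j ij) Ej.
Qed.

(** The union formula holds for every coset, so splitting amounts to disjointness. *)
Lemma preim_cyc_coset (m q : nat) (a : int) : (0 < m)%N -> odd q ->
  Zproj (2 * m) m @^-1: cyc_coset m q a =
  cyc_coset (2 * m) q a :|: cyc_coset (2 * m) q (m%:Z + a).
Proof.
move=> m0 q_odd; have m20 : (0 < 2 * m)%N by rewrite muln_gt0.
have mdv : (m %| 2 * m)%N by rewrite dvdn_mull.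
apply/setP => x; rewrite in_setU [LHS]in_set.
have [z ->] : exists z : int, x = residue (2 * m) z.
  exists (val x)%:Z; move: x; case: (2 * m)%N m20 => // N _ x; apply: val_inj.
  by rewrite /= modz_nat absz_nat modn_mod modn_small.
rewrite Zproj_residue //.
apply/cyc_cosetP/orP => [[j /(residue_eqP _ _ _ m0) /dvdzP[u Hu]]|]; last first.
  have dv : (m%:Z %| (2 * m)%N%:Z)%Z := mdv.
  case=> /cyc_cosetP[j /(residue_eqP _ _ _ m20) /(dvdz_trans dv) H]; exists j;
    apply/residue_eqP=> //.
  have -> : z - a * q%:Z ^+ j
            = z - (m%:Z + a) * q%:Z ^+ j + m%:Z * q%:Z ^+ j by ring.
  by rewrite rpredD // dvdz_mulr.
have /dvdzP[b Hb] : (2 %| q%:Z ^+ j - 1)%Z by have := oddz_exp q j q_odd; lia.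
have qE : q%:Z ^+ j = b * 2 + 1 by rewrite -Hb subrK.
(* Here z = a q^j + u m, and m q^j = m modulo 2m: the parity of u selects the coset. *)
case: (boolP (2 %| u)%Z) => [/dvdzP[k uk]|nu]; [left | right];
  apply/cyc_cosetP; exists j; apply/residue_eqP=> //; apply/dvdzP.
  by exists k; rewrite Hu uk PoszM; ring.
have [k uk] : exists k : int, u = k * 2 + 1 by exists (u %/ 2)%Z; lia.
exists (k - b).
have -> : z - (m%:Z + a) * q%:Z ^+ j = u * m%:Z - m%:Z * q%:Z ^+ j.
  by rewrite -Hu; ring.
by rewrite uk qE PoszM; ring.
Qed.

(** After division by 2^i, members of the two cosets have opposite parities, n being odd; the odd
    powers of q preserve parity. *)
Lemma splitting_of_pow2_dvd (i n q : nat) (a : int) :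
  (0 < n)%N -> odd n -> odd q -> (pow2 i %| a)%Z ->
  splitting_coset q (cyc_coset (2 ^ i * n) q a).
Proof.
move=> n0 n_odd q_odd /dvdzP[u Hu]; exists a; split=> //.
  by apply: preim_cyc_coset; rewrite ?expn2M_gt0.
have N0 : (0 < 2 * (2 ^ i * n))%N by rewrite mulnA -expnS expn2M_gt0.
apply/pred0P => y /=; apply/negP => /andP[/cyc_cosetP[j ->] /cyc_cosetP[k]].
move=> /(residue_eqP _ _ _ N0); rewrite mulnA -expnS dvdz_pow2M // => /andP[+ _].
have -> : a * q%:Z ^+ j - ((2 ^ i * n)%N%:Z + a) * q%:Z ^+ k
          = (u * q%:Z ^+ j - (n%:Z + u) * q%:Z ^+ k) * pow2 i.
  by rewrite Hu PoszM; ring.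
rewrite pow2S dvdz_mul2r ?pow2_neq0 //.
have := oddz_exp q j q_odd; have := oddz_exp q k q_odd.
move: (_ ^+ j) (_ ^+ k) => x z Hz Hx.
have [x' ->] : exists x', x = 2 * x' + 1 by exists (x %/ 2)%Z; lia.
have [z' ->] : exists x', z = 2 * x' + 1 by exists (z %/ 2)%Z; lia.
have [n' ->] : exists n' : nat, n = (2 * n' + 1)%N by exists n./2; lia.
lia.
Qed.

(** * Classification of the system when q^tau = 3 mod 4 *)

Section ThreeModFour.

Variables (n q tau : nat) (g : int).
Hypotheses (n0 : (0 < n)%N) (n_odd : odd n) (q_odd : odd q) (nq : coprime n q).
Hypothesis tauE : #|cyc_coset n q g| = tau.
Hypothesis Q3 : (q ^ tau = 3 %[mod 4])%N.
Let v := logn 2 (q ^ tau + 1).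

Lemma not_splitting_exact_pow2 d (a : int) :
  (n%:Z %| a - g)%Z -> exact_pow2 d a ->
  ~ splitting_coset q (cyc_coset (2 ^ d.+1 * n) q a).
Proof.
move=> Ha da [b [E _ /disjoint_setI0]].
have N0 : (0 < 2 ^ d.+1 * n)%N by rewrite expn2M_gt0.
have Nq := coprime_pow2M d.+1 _ _ q_odd nq.
have N20 : (0 < 2 * (2 ^ d.+1 * n))%N by rewrite mulnA -expnS expn2M_gt0.
have N2q : coprime (2 * (2 ^ d.+1 * n)) q.
  by rewrite mulnA -expnS; apply: coprime_pow2M.
(* Splitting comes with its own representative b, to which valuation and period are transferred. *)
have db : exact_pow2 d b.
  case/(cyc_coset_eqP _ _ _ _ N0 Nq): (E) => j; rewrite dvdz_pow2M // => /andP[H _].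
  by rewrite (exact_pow2_sub _ _ _ H) exact_pow2_odd ?oddz_exp.
have taub : #|cyc_coset n q b| = tau.
  rewrite -tauE -(coset_proj_cyc_coset _ _ N0) ?dvdn_mull // -E.
  by rewrite coset_proj_cyc_coset ?dvdn_mull // (eq_cyc_coset _ _ _ _ n0 Ha).
suff -> : cyc_coset (2 * (2 ^ d.+1 * n)) q ((2 ^ d.+1 * n)%N%:Z + b)
          = cyc_coset (2 * (2 ^ d.+1 * n)) q b.
  by rewrite setIid => /setP/(_ (residue _ b)); rewrite !inE connect0.
(* Since q^tau - 1 is twice an odd number, b q^tau - b is an odd multiple of 2^(d+1), so it equals
   2^(d+1) n modulo 2^(d+2); modulo n both vanish. *)
apply/esym/cyc_coset_eqP => //; exists tau.
rewrite mulnA -expnS dvdz_pow2M //; apply/andP; split; last first.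
  rewrite -addrA rpredD //; first by rewrite PoszM dvdz_mull.
  apply: dvdz_sub_sym.
  by rewrite dvd_card_cyc_coset // taub.
have /exact_pow2P[y ->] := db.
have [m Hm] : exists m, (q ^ tau = 4 * m + 3)%N by exists (q ^ tau %/ 4)%N; lia.
have -> : q%:Z ^+ tau = (q ^ tau)%N%:Z by rewrite -[RHS]natz natrX natz.
rewrite Hm.
have [n' ->] : exists n' : nat, n = (2 * n' + 1)%N by exists n./2; lia.
apply/dvdzP; exists (n'%:Z - (2 * y * m%:Z + m%:Z + y)).
rewrite !pow2S !(PoszM, PoszD) -/(pow2 _) !pow2S; ring.
Qed.

Lemma c_infty_splitting : splitting_system q (c_infty n q g).
Proof.
case=> [|i]; apply: splitting_of_pow2_dvd => //.
exact: cyc_2adicP.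
Qed.

Lemma dvdz_system_of (Y : nat -> nat) i :
  (n%:Z %| g + (n * trunc Y i)%N%:Z - g)%Z.
Proof. by rewrite addrAC subrr add0r PoszM dvdz_mulr. Qed.

Lemma c_fin_not_splitting d w (t : w.-tuple bool) :
  ~ splitting_system q (c_fin n q g d t).
Proof.
move/(_ d.+1); apply: not_splitting_exact_pow2; first exact: dvdz_system_of.
exact: exact_pow2_generator_hat.
Qed.

Lemma c_fin_inj d d' (t t' : v.-1.-tuple bool) :
  c_fin n q g d t = c_fin n q g d' t' -> d = d' /\ t = t'.
Proof.
move=> E.
have orb j : exists k, (pow2 j %|
    g + (n * trunc (generator_hat n g d' t') j)%N%:Z -
    (g + (n * trunc (generator_hat n g d t) j)%N%:Z) * (q ^ tau)%N%:Z ^+ k)%Z.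
  have := congr1 (fun c : coset_system n => c j) E.
  by case/(cyc_coset_fibre_eqP _ _ _ tau g) => //;
    try exact: dvdz_system_of; move=> k; exists k.
have dd : d = d'.
  have [k Hk] := orb (d + d').+1.
  have dlt : (d < (d + d').+1)%N by rewrite ltnS leq_addr.
  apply: (@exact_pow2_inj _ _
    (g + (n * trunc (generator_hat n g d' t') (d + d').+1)%N%:Z)).
    rewrite (exact_pow2_orbit _ Q3 _ _ _ _ _ dlt Hk).
    exact: exact_pow2_generator_hat.
  by apply: exact_pow2_generator_hat; rewrite // ltnS leq_addl.
subst d'; split=> //.
(* Precision d+v+1 covers the d+2 digits shared by all t, then exactly the v-1 digits of t. *)
have vE : (d + v.+1 = d.+2 + v.-1)%N by have := logn2_ge2 _ Q3; rewrite -/v; lia.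
have [k Hk] := orb (d + v.+1)%N.
have trE : trunc (generator_hat n g d t) d.+2 = trunc (generator_hat n g d t') d.+2.
  by apply: eq_trunc => i id; rewrite !generator_hat_low.
have da : exact_pow2 d (g + (n * trunc (generator_hat n g d t) (d + v.+1))%N%:Z).
  by apply: exact_pow2_generator_hat; lia.
have {}Hk := close_of_orbit _ Q3 _ _ _ _ da _ Hk.
have /Hk/dvdz_sub_sym : (pow2 d.+2 %|
    g + (n * trunc (generator_hat n g d t') (d + v.+1))%N%:Z -
    (g + (n * trunc (generator_hat n g d t) (d + v.+1))%N%:Z))%Z.
  rewrite opprD addrACA subrr add0r !PoszM -mulrBr dvdz_mull //.
  apply: (@dvdz_sub_trans _ _ (trunc (generator_hat n g d t) d.+2)%:Z).
    by rewrite trE; apply: truncB_dvd; lia.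
  by apply: dvdz_sub_sym; apply: truncB_dvd; lia.
move/(trunc_affine_inj _ _ _ _ _ n_odd (generator_hat_le1 _ _ _ _ _)
  (generator_hat_le1 _ _ _ _ _)) => /trunc_inj E'.
apply: val_inj; apply: (@eq_from_nth _ false); rewrite ?size_tuple // => m mw.
have := E' (generator_hat_le1 _ _ _ _ _) (generator_hat_le1 _ _ _ _ _) (d.+2 + m)%N.
by rewrite !generator_hat_high vE ltn_add2l => /(_ mw); do 2!case: nth.
Qed.

Lemma exists_c_fin_close d (a : int) : exact_pow2 d a ->
  exists (t : v.-1.-tuple bool) k, forall j,
  (pow2 (d + v.+1) %|
    g + (n * trunc (generator_hat n g d t) (d + v.+1 + j))%N%:Z
    - a * (q ^ tau)%N%:Z ^+ k)%Z.
Proof.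
move=> da; have v2 : (2 <= v)%N := logn2_ge2 _ Q3.
have vE : (d + v.+1 = d.+2 + v.-1)%N by lia.
(* Any tuple serves here: digits below d+2 do not depend on it. *)
pose t0 : v.-1.-tuple bool := [tuple of nseq v.-1 false].
have d0 := exact_pow2_generator_hat n g _ d t0 _ n_odd (leqnSn d.+1).
have [k Hk] := orbit_mod_pow2SS _ Q3 _ _ _ da d0.
pose b := a * (q ^ tau)%N%:Z ^+ k; rewrite -/b in Hk.
(* [psi] is the 2-adic integer with g + n psi = b; t is read off its digits from degree d+2 on. *)
pose psi := cyc_2adic n (g - b).
have psiP j : (pow2 j %| g + (n * trunc psi j)%N%:Z - b)%Z.
  rewrite addrAC; case: j => [|j]; first by rewrite expn0 dvd1z.
  exact: (cyc_2adicP (g - b) n_odd j).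
pose t := [tuple of mkseq (fun m => psi (d.+2 + m)%N) v.-1].
have trE : trunc (generator_hat n g d t) (d + v.+1) = trunc psi (d + v.+1).
  have E0 : trunc (generator_hat n g d t) d.+2 = trunc psi d.+2.
    apply: (trunc_affine_inj _ _ g _ _ n_odd).
    - exact: generator_hat_le1.
    - by move=> m; apply: leq_b1.
    apply: dvdz_sub_trans (dvdz_sub_sym _ _ _ (psiP d.+2)).
    rewrite (eq_trunc _ (generator_hat n g d t0)) // => m md.
    by rewrite !generator_hat_low.
  have Em m : (m <= v.-1)%N ->
      trunc (generator_hat n g d t) (d.+2 + m) = trunc psi (d.+2 + m).
    elim: m => [|m IHm] mw; first by rewrite addn0.
    by rewrite addnS !(truncS _ (d.+2 + m)) IHm 1?ltnW // generator_hat_high nth_mkseq.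
  by rewrite vE Em.
exists t, k => j; apply: dvdz_sub_trans (psiP _); rewrite -trE.
rewrite opprD addrACA subrr add0r !PoszM -mulrBr dvdz_mull //.
by apply: truncB_dvd; apply: leq_addr.
Qed.

Lemma PC_exhaust (c : coset_system n) : PC n q g c ->
  c = c_infty n q g \/ exists d (t : v.-1.-tuple bool), c = c_fin n q g d t.
Proof.
move=> cPC; have [cC cP] := cPC.
have N0 i : (0 < 2 ^ i * n)%N by apply: expn2M_gt0.
have rep i : exists2 a, (n%:Z %| a - g)%Z & c i = cyc_coset (2 ^ i * n) q a.
  have [[a ->] Ea] := cC i; move: Ea; rewrite coset_proj_cyc_coset ?dvdn_mull //.
  by apply: cyc_coset_rep; rewrite ?dvdn_mull ?coprime_pow2M.
case: (classic (exists i a, [/\ (n%:Z %| a - g)%Z,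
    c i = cyc_coset (2 ^ i * n) q a & ~~ (pow2 i %| a)%Z])) => [|none]; last first.
  left; apply: PC_ext cPC (PC_system_of _ _ _ _ n0) _ => i; exists i => //.
  have [a Ha Ea] := rep i; rewrite Ea; apply/cyc_coset_fibre_eqP; try eassumption.
    exact: dvdz_system_of.
  exists 0%N; rewrite expr0 mulr1 rpredB //.
    by case: i {a Ha Ea} => [|i]; [rewrite expn0 dvd1z | apply: cyc_2adicP].
  by apply: contraT => na; case: none; exists i, a.
case=> i [a [Ha Ea na]]; right.
have [d di da] : exists2 d, (d < i)%N & exact_pow2 d a.
  elim: i na {Ea} => [|i IHi] na; first by rewrite expn0 dvd1z in na.
  case: (boolP (pow2 i %| a)%Z) => [H|/IHi[d di da]].
    by exists i; rewrite // /exact_pow2 H.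
  by exists d; rewrite // ltnW.
(* Level M lies above i, so the valuation d is visible, and reaches d+v+1, so t is determined there
   once for all higher levels. *)
pose M := (d + v.+1 + i)%N.
have [b Hb Eb] := rep M.
have Eproj j (x : int) : (M <= j)%N ->
    coset_proj (2 ^ j * n) (2 ^ M * n) (cyc_coset (2 ^ j * n) q x) =
    cyc_coset (2 ^ M * n) q x.
  by move=> Mj; rewrite coset_proj_cyc_coset ?dvdn_mul ?dvdn_exp2l.
have db : exact_pow2 d b.
  have : cyc_coset (2 ^ i * n) q b = cyc_coset (2 ^ i * n) q a.
    rewrite -Ea -(cP i M) ?leq_addl // Eb coset_proj_cyc_coset //.
    by rewrite dvdn_mul ?dvdn_exp2l ?leq_addl.
  case/(cyc_coset_fibre_eqP _ _ _ _ _ _ _ n0 n_odd q_odd nq tauE Hb Ha) => k Hk.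
  by rewrite -(exact_pow2_orbit _ Q3 _ _ _ _ _ di Hk).
have [t [k Hk]] := exists_c_fin_close d b db.
exists d, t; apply: PC_ext cPC (PC_system_of _ _ _ _ n0) _ => j.
exists (M + j)%N; first exact: leq_addl.
have [x Hx Ex] := rep (M + j)%N.
have : cyc_coset (2 ^ M * n) q x = cyc_coset (2 ^ M * n) q b.
  by rewrite -Eb -(cP M (M + j)%N) ?leq_addr // Ex Eproj ?leq_addr.
case/(cyc_coset_fibre_eqP _ _ _ _ _ _ _ n0 n_odd q_odd nq tauE Hx Hb) => l Hl.
rewrite Ex; apply/cyc_coset_fibre_eqP; try eassumption.
  exact: dvdz_system_of.
have dxl : exact_pow2 d (x * (q ^ tau)%N%:Z ^+ (l + k)).
  rewrite exact_pow2_odd ?oddz_exp ?oddX ?q_odd ?orbT //.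
  rewrite -(exact_pow2_orbit _ Q3 _ _ _ _ _ _ Hl) //.
  exact: leq_trans di (leq_addl _ _).
have close : (pow2 (d + v.+1) %|
    g + (n * trunc (generator_hat n g d t) (M + j))%N%:Z
    - x * (q ^ tau)%N%:Z ^+ (l + k))%Z.
  have := Hk (i + j)%N; rewrite addnA -/M => /dvdz_sub_trans; apply.
  rewrite exprD mulrA -mulrBl dvdz_mulr //.
  by apply: dvdz_pow2 Hl; apply: leq_addr.
(* Closeness at the fixed precision d+v+1 is lifted to level M+j with the same t. *)
have [m Hm] := orbit_of_close _ Q3 _ _ _ (M + j)%N dxl close.
by exists (l + k + m)%N; rewrite exprD mulrA.
Qed.

End ThreeModFour.

Theorem theorem3p3
  (p e q n : nat) (gamma : int) (tau v : nat)
  (p_prime : prime p) (p_odd : odd p) (e_gt0 : (0 < e)%N) (q_def : q = (p ^ e)%N)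
  (n_gt0 : (0 < n)%N) (n_odd : odd n) (n_q : coprime n q)
  (tau_def : #|cyc_coset n q gamma| = tau)
  (q_tau : (q ^ tau = 3 %[mod 4])%N)
  (v_def : v = logn 2 (q ^ tau + 1)) :
  [/\ [/\ PC n q gamma (c_infty n q gamma),
          splitting_system q (c_infty n q gamma)
        & forall c : coset_system n,
            PC n q gamma c -> splitting_system q c -> c = c_infty n q gamma],
      forall (d : nat) (t : (v.-1).-tuple bool),
        PC n q gamma (c_fin n q gamma d t),
      (forall (d : nat) (t : (v.-1).-tuple bool),
         c_infty n q gamma <> c_fin n q gamma d t) /\
      (forall (d d' : nat) (t t' : (v.-1).-tuple bool),
         c_fin n q gamma d t = c_fin n q gamma d' t' -> d = d' /\ t = t')
    & forall c : coset_system n,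
        PC n q gamma c ->
        c = c_infty n q gamma \/
        exists (d : nat) (t : (v.-1).-tuple bool), c = c_fin n q gamma d t].
Proof.
have q_odd : odd q by rewrite q_def oddX p_odd orbT.
subst v; split.
- split=> [||c cPC c_split]; first exact: PC_system_of.
    exact: c_infty_splitting.
  (* Uniqueness follows from exhaustion, since no [c_fin] splits at every degree. *)
  case: (PC_exhaust _ _ _ _ n_gt0 n_odd q_odd n_q tau_def q_tau c cPC) => // -[d [t E]].
  case: (c_fin_not_splitting _ _ _ _ n_gt0 n_odd q_odd n_q tau_def q_tau d _ t).
  by rewrite -E.
- by move=> d t; apply: PC_system_of.
- split=> [d t E|d d' t t'].
    apply: (c_fin_not_splitting _ _ _ _ n_gt0 n_odd q_odd n_q tau_def q_tau d _ t).
    by rewrite -E; apply: c_infty_splitting.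
  exact: (c_fin_inj _ _ _ _ n_gt0 n_odd q_odd n_q tau_def q_tau).
- exact: (PC_exhaust _ _ _ _ n_gt0 n_odd q_odd n_q tau_def q_tau).
Qed.
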